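(* For all integers $n\ge 28$, \[ C(n) \le \frac12\log\!\left(\frac{n\pi}{2e}\right) + r_{\rm UB}(n),\qquad r_{\rm UB}(n) := -\log\!\left(1-2\left(\frac{2e}{n\pi}\right)^{1/4}\right)+\frac{10}{\log\frac{n\pi}{2e}}. \]
   Context: All logarithms are natural. For an integer $n\ge1$, the binomial channel has input $X\in[0,1]$, output $Y\in\{0,\dots,n\}$ and transition law $P_{Y|X}(y|x)=\binom{n}{y}x^y(1-x)^{n-y}$. Its capacity is $C(n)=\max_{P_X} I(X;Y)$, the maximum taken over all probability distributions $P_X$ on $[0,1]$. *)

(* Defs.v *)
From HB Require Import structures.
From mathcomp Require Import all_boot all_order all_algebra.
From mathcomp Require Import all_classical all_reals all_analysis.
Set Implicit Arguments. Unset Strict Implicit. Unset Printing Implicit Defensive.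
Import Order.TTheory GRing.Theory Num.Theory.
Local Open Scope classical_set_scope.
Local Open Scope ring_scope.

Definition binom_W {R : realType} (n y : nat) (x : R) : R :=
  'C(n, y)%:R * x ^+ y * (1 - x) ^+ (n - y).

Definition binom_out {R : realType} (P : probability R R) (n y : nat) : R :=
  Rintegral P `[0, 1]%classic (fun x => binom_W n y x).

(* Mutual information I(X;Y) = sum_y \int W(y|x) log (W(y|x)/P_Y(y)) dP_X(x),
   natural log, with the convention 0 log 0 = 0 (ln 0 = 0 in the library). *)
Definition binom_MI {R : realType} (P : probability R R) (n : nat) : R :=
  \sum_(y < n.+1)
    Rintegral P `[0, 1]%classic
      (fun x => binom_W n y x * ln (binom_W n y x / binom_out P n y)).

Definition r_UB {R : realType} (n : nat) : R :=
  - ln (1 - 2 * powR ((2 * expR 1) / (n%:R * pi)) (4^-1))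
  + 10 / ln ((n%:R * pi) / (2 * expR 1)).

(* Main.v *)
(* For any output law [q], [I(X;Y)] is at most the maximum over [x] of the
   divergence of [Bin(n, x)] from [q]. Put [l = ln (n pi / 2e)] and
   [e = exp (- l / 4)], and take for [q] the output law of the Jeffreys prior,
   [C(2k,k) C(2(n-k),n-k) / 4^n], with weight [1 - 2e], mixed with geometric laws
   at both ends of [0, n], each with weight [e].
   If [v = n x (1 - x) >= l / 10], the Jeffreys component alone gives
   [l / 2 + 1 / v - ln (1 - 2e)]: explicit Stirling and Wallis bounds reduce the
   divergence to [- E[k ln (k / nx)] - E[(n - k) ln ((n - k) / n(1 - x))]], whose
   value [- 1/2 + O(1/v)] follows from a third-order Taylor minorant of [u ln u]
   and the first three binomial moments.
   If [v < l / 10], the geometric component nearest to [x] gives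
   [l / 4 + (2 v + 1) ln 2 <= l / 2 + 10 / l].
   When [1 - 2e <= 0], [n] is so small that [ln (n + 1)] is below the bound. *)

Require Import Defs.
From HB Require Import structures.
From mathcomp Require Import all_boot all_order all_algebra.
From mathcomp Require Import all_classical all_reals all_analysis.
From mathcomp Require Import measurable_realfun zify ring lra.
Import Order.TTheory GRing.Theory Num.Theory.
Local Open Scope classical_set_scope.
Local Open Scope ring_scope.

(** * Inequalities for the logarithm *)

Lemma ge0_is_derive_le (R : realType) (g dg : R -> R) (x y : R) : x <= y ->
  (forall z, x <= z <= y -> is_derive z 1 g (dg z)) ->
  (forall z, x <= z <= y -> 0 <= dg z) -> g x <= g y.
Proof.
move=> le_xy g_dg dg_ge0.
apply: (@ger0_derive1_le_cc _ g x y) => //; rewrite ?in_itv /= ?lexx ?le_xy //.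
- by move=> z /subset_itv_oo_cc; rewrite in_itv /= => /g_dg [].
- move=> z /subset_itv_oo_cc; rewrite in_itv /= => xzy.
  by have := g_dg z xzy; rewrite derive1E => -[_ ->]; exact: dg_ge0.
- apply: derivable_within_continuous => z.
  by rewrite in_itv /= => /g_dg [].
Qed.

Lemma ln_le_subr1 (R : realType) (u : R) : 0 < u -> ln u <= u - 1.
Proof.
by move=> u_gt0; rewrite -[X in ln X](subrKC 1 u) le_ln1Dx //; lra.
Qed.

(** The gap vanishes at [1] and has derivative [ln z + 1/z - 1], nonnegative by [ln_le_subr1] at
    [1/z]. With [s = ln u] this is [tanh (s/2) <= s/2]. *)
Lemma ln_ge_pade (R : realType) (u : R) :
  1 <= u -> 2 * (u - 1) <= (u + 1) * ln u.
Proof.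
move=> u_ge1.
pose g (z : R) := (z + 1) * ln z - 2 * (z - 1).
suff: g 1 <= g u by rewrite /g ln1; lra.
apply: (@ge0_is_derive_le _ g (fun z => ln z + (z + 1) * z^-1 - 2) 1 u u_ge1) => z.
  move=> /andP[z_ge1 _]; have z_gt0 : 0 < z by lra.
  have := is_derive1_ln z_gt0 => dln.
  by rewrite /g; apply: is_derive_eq; rewrite /GRing.scale /=; ring.
move=> /andP[z_ge1 _]; have z_gt0 : 0 < z by lra.
have := @ln_le_subr1 _ z^-1; rewrite invr_gt0 lnV ?posrE // => /(_ z_gt0).
by rewrite mulrDl divff ?gt_eqF //; lra.
Qed.

(** With [s = ln u] this is [s <= sinh s]. Together with [ln_ge_pade] it controls one step of the
    Stirling sequence from both sides. *)
Lemma ln_le_sqr (R : realType) (u : R) :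
  1 <= u -> 2 * u * ln u <= u ^+ 2 - 1.
Proof.
move=> u_ge1.
pose g (z : R) := z * z - 1 - 2 * (z * ln z).
suff: g 1 <= g u by rewrite /g ln1; lra.
apply: (@ge0_is_derive_le _ g (fun z => 2 * (z - 1 - ln z)) 1 u u_ge1) => z.
  move=> /andP[z_ge1 _]; have z_gt0 : 0 < z by lra.
  have := is_derive1_ln z_gt0 => dln.
  rewrite /g; apply: is_derive_eq; rewrite /GRing.scale /= divff ?gt_eqF //; ring.
move=> /andP[z_ge1 _]; have : ln z <= z - 1 by apply: ln_le_subr1; lra.
lra.
Qed.

(** The derivative is [(z - 1)^2 / z]. The function compared here is the derivative of the gap in
    [xlnx_ge_taylor3]. *)
Lemma ln_taylor2_homo (R : realType) (u v : R) : 0 < u -> u <= v ->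
  ln u - (u - 1) + (u - 1) * (u - 1) / 2 <= ln v - (v - 1) + (v - 1) * (v - 1) / 2.
Proof.
move=> u_gt0 le_uv.
pose g (z : R) := ln z - (z - 1) + (z - 1) * (z - 1) / 2.
apply: (@ge0_is_derive_le _ g (fun z => z^-1 - 1 + (z - 1)) u v le_uv) => z.
  move=> /andP[le_uz _]; have z_gt0 : 0 < z by lra.
  have := is_derive1_ln z_gt0 => dln.
  by rewrite /g; apply: is_derive_eq; rewrite /GRing.scale /=; field; rewrite gt_eqF.
move=> /andP[le_uz _]; have z_gt0 : 0 < z by lra.
have -> : z^-1 - 1 + (z - 1) = (z - 1) ^+ 2 / z by field; rewrite gt_eqF.
by rewrite divr_ge0 ?sqr_ge0 // ltW.
Qed.

(** The cubic is the Taylor polynomial at [1]. The gap [h] and its derivative [dh] vanish at [1],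
    and [dh] is nondecreasing, so [h] is minimal at [1]. *)
Lemma xlnx_ge_taylor3 (R : realType) (u : R) : 0 <= u ->
  (u - 1) + (u - 1) ^+ 2 / 2 - (u - 1) ^+ 3 / 6 <= u * ln u.
Proof.
rewrite le0r => /orP[/eqP -> | u_gt0]; first by rewrite mul0r; lra.
pose h (z : R) := z * ln z - (z - 1) - (z - 1) * (z - 1) / 2
  + (z - 1) * (z - 1) * (z - 1) / 6.
suff h_ge0 : 0 <= h u.
  by move: h_ge0; rewrite /h !exprS expr0; lra.
pose dh (z : R) := ln z - (z - 1) + (z - 1) * (z - 1) / 2.
have h_dh (z : R) : 0 < z -> is_derive z 1 h (dh z).
  move=> z_gt0; have := is_derive1_ln z_gt0 => dln.
  rewrite /h /dh; apply: is_derive_eq.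
  by rewrite /GRing.scale /= divff ?gt_eqF //; field.
have h1 : h 1 = 0 by rewrite /h ln1; ring.
have dh1 : dh 1 = 0 by rewrite /dh ln1; ring.
have [u_ge1 | u_lt1] := leP 1 u.
  rewrite -h1; apply: (@ge0_is_derive_le _ h dh 1 u u_ge1) => z /andP[z_ge1 _].
    by apply: h_dh; lra.
  by rewrite -dh1; apply: ln_taylor2_homo.
(* Left of [1], [dh <= 0], so [- h] increases up to [- h 1 = 0]. *)
rewrite -oppr_le0 -[0]oppr0 -h1.
apply: (@ge0_is_derive_le _ (fun z : R => - h z) (fun z : R => - dh z)) => [|z|z].
- exact: ltW.
- move=> /andP[uz _]; have hz := h_dh z (lt_le_trans u_gt0 uz).
  exact: is_deriveN.
- move=> /andP[uz z_le1]; rewrite oppr_ge0 -dh1.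
  exact: ln_taylor2_homo (lt_le_trans u_gt0 uz) z_le1.
Qed.

(** * Central binomial ratios and the Wallis inequality *)

(* [C(2k,k) / 4^k], the Beta(1/2,1/2) moment of order [k]; see [cbr_fact]. *)
Fixpoint cbr (R : realType) (k : nat) : R :=
  if k is j.+1 then cbr R j * ((2 * j%:R + 1) / (2 * j%:R + 2)) else 1.

Lemma cbr_gt0 (R : realType) (k : nat) : 0 < cbr R k.
Proof.
elim: k => [|k IH] //=; have := ler0n R k => k_ge0.
by rewrite mulr_gt0 // divr_gt0 //; lra.
Qed.

Lemma cbr_fact (R : realType) (k : nat) :
  (k`!%:R) ^+ 2 * cbr R k * 4 ^+ k = (k.*2)`!%:R.
Proof.
elim: k => [|k IH]; first by rewrite /= fact0 expr0; ring.
rewrite doubleS !factS !natrM -IH -[k.*2.+2%:R]natr1 -[k.*2.+1%:R]natr1 -muln2 natrM.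
rewrite -[k.+1%:R]natr1 /=; have := ler0n R k => k_ge0.
by rewrite [4 ^+ _]exprS; field; lra.
Qed.

(* [T] is the convolution and [S] its first moment: reversal gives
   [2 S m = m T m], the recurrence for [cbr] gives [2 S (m+1) = 2 S m + T m]. *)
Lemma sum_cbr_cbr (R : realType) (n : nat) :
  \sum_(i < n.+1) cbr R i * cbr R (n - i) = 1.
Proof.
pose T m : R := \sum_(i < m.+1) cbr R i * cbr R (m - i).
pose S m : R := \sum_(i < m.+1) i%:R * (cbr R i * cbr R (m - i)).
have ST m : 2 * S m = m%:R * T m.
  have S_rev : S m = \sum_(i < m.+1) (m%:R - i%:R) * (cbr R i * cbr R (m - i)).
    rewrite /S (reindex_inj rev_ord_inj) /=; apply: eq_bigr => i _.
    have le_im : (i <= m)%N by rewrite -ltnS.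
    by rewrite subSS subKn // natrB //; congr (_ * _); rewrite mulrC.
  rewrite mulr_natl mulr2n {2}S_rev /S /T -big_split mulr_sumr /=.
  by apply: eq_bigr => i _; ring.
have Srec m : 2 * S m.+1 = 2 * S m + T m.
  rewrite /S big_ord_recl mul0r add0r /T !mulr_sumr -big_split /=.
  apply: eq_bigr => i _; rewrite /bump /= add1n subSS -natr1.
  have := ler0n R i => i_ge0; field; lra.
elim: n => [|n IH]; first by rewrite big_ord1 /= mulr1.
rewrite -/(T _) in IH *.
have n_neq0 : n.+1%:R != 0 :> R by rewrite pnatr_eq0.
by apply: (mulfI n_neq0); rewrite mulr1 -ST Srec ST IH mulr1 natr1.
Qed.

(** The primitive of [cos ^+ m] vanishing at [0], given by the reduction formula from integration by
    parts, so that Wallis integrals become plain evaluations at [pi / 2]. *)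
Fixpoint cos_primitive (R : realType) (m : nat) (x : R) : R :=
  match m with
  | 0 => x
  | 1 => sin x
  | j.+2 =>
    (cos x ^+ j.+1 * sin x + j.+1%:R * cos_primitive R j x) / j.+2%:R
  end.

Lemma is_derive_cos_primitive (R : realType) (m : nat) (x : R) :
  is_derive x 1 (cos_primitive R m) (cos x ^+ m).
Proof.
have [p] := ubnP m; elim: p m => // p IH [|[|m]] lt_mp.
- rewrite expr0; exact: is_derive_id.
- rewrite expr1; exact: is_derive_sin.
have dF : is_derive x 1 (cos_primitive R m) (cos x ^+ m) by apply: IH; lia.
have dcX : is_derive x 1 (fun z : R => cos z ^+ m.+1)
    (m.+1%:R * cos x ^+ m * - sin x).
  have -> : (fun z : R => cos z ^+ m.+1) = cos ^+ m.+1.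
    by apply/funext => z; rewrite exprfctE.
  by apply: is_derive_eq; rewrite /GRing.scale /= mulr_natl.
rewrite /=; apply: is_derive_eq; rewrite /GRing.scale /=.
(* The derivative of the numerator is [cos^(m+2) - (m+1) cos^m sin^2 + (m+1) cos^m], which collapses
   to [(m+2) cos^(m+2)]. *)
have sinE : sin x * sin x = 1 - cos x * cos x.
  by have := cos2Dsin2 x; rewrite !expr2; lra.
apply: (@mulIf _ m.+2%:R); first by rewrite pnatr_eq0.
rewrite !mulr0 add0r mulrAC mulVf ?pnatr_eq0 // mul1r !exprS -(natr1 m.+1).
transitivity (cos x * (cos x * cos x ^+ m) +
  m.+1%:R * cos x ^+ m * (1 - sin x * sin x)); first by ring.
by rewrite sinE; ring.
Qed.

Lemma cos_primitive0 (R : realType) (m : nat) : cos_primitive R m 0 = 0.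
Proof.
have [p] := ubnP m; elim: p m => // p IH [|[|m]] lt_mp //=; first exact: sin0.
by rewrite sin0 IH ?mulr0 ?addr0 ?mul0r //; lia.
Qed.

(** At [pi / 2] the boundary term of the reduction formula vanishes, leaving the recurrence of
    [cbr]. *)
Lemma cos_primitive_even (R : realType) (k : nat) :
  cos_primitive R k.*2 (pi / 2) = cbr R k * (pi / 2).
Proof.
elim: k => [|k IH]; first by rewrite /= mul1r.
rewrite doubleS /= IH cos_pihalf expr0n /= mul0r add0r.
rewrite -[k.*2.+2%:R]natr1 -[k.*2.+1%:R]natr1 -muln2 natrM.
by have := ler0n R k => k_ge0; field; lra.
Qed.

Lemma cos_primitive_odd (R : realType) (k : nat) :
  cos_primitive R k.*2.+1 (pi / 2) = ((2 * k%:R + 1) * cbr R k)^-1.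
Proof.
elim: k => [|k IH]; first by rewrite /= sin_pihalf mulr1 mulr0 add0r invr1.
rewrite doubleS /= in IH *; rewrite IH cos_pihalf expr0n /= mul0r add0r.
rewrite -[k.*2.+3%:R]natr1 -[k.*2.+2%:R]natr1 -[k.*2.+1%:R]natr1 -[k.+1%:R]natr1.
rewrite -muln2 natrM; have := ler0n R k => k_ge0; have := cbr_gt0 R k => f_gt0.
by field; lra.
Qed.

(* The integrals of [cos ^+ m] over [0, pi/2] decrease with [m]. *)
Lemma wallis_ge (R : realType) (k : nat) :
  2 <= pi * ((2 * k%:R + 1) * cbr R k ^+ 2).
Proof.
have pi2 := pihalf_02 R.
suff : cos_primitive R k.*2.+1 (pi / 2) <= cos_primitive R k.*2 (pi / 2) :> R.
  have := ler0n R k => k_ge0; have := cbr_gt0 R k => f_gt0.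
  have c_gt0 : 0 < (2 * k%:R + 1) * cbr R k by apply: mulr_gt0 => //; lra.
  rewrite cos_primitive_even cos_primitive_odd -(ler_pM2l c_gt0) divff ?gt_eqF //.
  lra.
rewrite -subr_ge0.
pose g (z : R) := cos_primitive R k.*2 z - cos_primitive R k.*2.+1 z.
have -> : 0 = g 0 by rewrite /g !cos_primitive0 subr0.
rewrite -/(g _).
apply: (@ge0_is_derive_le _ g (fun z => cos z ^+ k.*2 - cos z ^+ k.*2.+1)) => [|z _|z].
- lra.
- have dF := @is_derive_cos_primitive R k.*2 z.
  have dG := @is_derive_cos_primitive R k.*2.+1 z.
  exact: is_deriveB.
- move=> zpi; have c_ge0 : 0 <= cos z by apply: cos_ge0_pihalf; lra.
  by rewrite subr_ge0 exprS ler_piMl ?exprn_ge0 ?cos_le1.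
Qed.

(** * Stirling bounds *)

(** The logarithm of [k! / (sqrt k (k/e)^k)] for positive [k], decreasing to [ln (sqrt (2 pi))]. *)
Definition stirling_seq (R : realType) (k : nat) : R :=
  ln k`!%:R - (k%:R + 2^-1) * ln k%:R + k%:R.

(** With [u = (k+1)/k] the step is [(k + 1/2) ln u - 1]; [ln_ge_pade] bounds it below and
    [ln_le_sqr] above. *)
Lemma stirling_seq_step (R : realType) (k : nat) : (0 < k)%N ->
  0 <= stirling_seq R k - stirling_seq R k.+1 <= (k%:R^-1 - k.+1%:R^-1) / 4.
Proof.
move=> k_gt0; have k0 : 0 < k%:R :> R by rewrite ltr0n.
have -> : stirling_seq R k - stirling_seq R k.+1
    = (k%:R + 2^-1) * ln (k.+1%:R / k%:R) - 1.
  rewrite /stirling_seq factS natrM lnM ?posrE ?ltr0n ?fact_gt0 //.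
  by rewrite ln_div ?posrE ?ltr0n // -[k.+1%:R]natr1; field.
rewrite -[k.+1%:R]natr1; set x : R := k%:R in k0 *.
have u_ge1 : 1 <= (x + 1) / x by rewrite ler_pdivlMr //; lra.
set u := (x + 1) / x in u_ge1 *.
have xuE : x * u = x + 1 by rewrite /u mulrC divfK // gt_eqF.
have lo := ln_ge_pade R u u_ge1; have hi := ln_le_sqr R u u_ge1.
apply/andP; split.
  have : x * (2 * (u - 1)) <= x * ((u + 1) * ln u) by rewrite ler_pM2l.
  have -> : x * (2 * (u - 1)) = 2 by rewrite mulrCA mulrBr xuE; ring.
  have -> : x * ((u + 1) * ln u) = (2 * x + 1) * ln u.
    by rewrite mulrA mulrDr xuE; ring.
  by move=> h; move: (ln u) h => l h; lra.
have x1_gt0 : 0 < 4 * x * (x + 1) by rewrite !mulr_gt0 //; lra.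
have -> : (x^-1 - (x + 1)^-1) / 4 = (4 * x * (x + 1))^-1 by field; lra.
rewrite -(ler_pM2l x1_gt0) divff ?gt_eqF //.
have : x ^+ 2 * (2 * u * ln u) <= x ^+ 2 * (u ^+ 2 - 1).
  by rewrite ler_pM2l // exprn_gt0.
have -> : x ^+ 2 * (u ^+ 2 - 1) = 2 * x + 1.
  by rewrite mulrBr -exprMn xuE; ring.
have -> : x ^+ 2 * (2 * u * ln u) = 2 * x * (x + 1) * ln u.
  by rewrite -xuE; ring.
(* The factor [2x + 1] gives [(2x+1)^2 = 4x(x+1) + 1], and the extra [1] is exactly the allowed
   error. *)
move=> h.
have : (2 * x + 1) * (2 * x * (x + 1) * ln u) <= (2 * x + 1) * (2 * x + 1).
  by rewrite ler_pM2l //; lra.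
have -> : 4 * x * (x + 1) * ((x + 2^-1) * ln u - 1)
    = (2 * x + 1) * (2 * x * (x + 1) * ln u) - 4 * x * (x + 1) by field.
have -> : (2 * x + 1) * (2 * x + 1) = 4 * x * (x + 1) + 1 by ring.
move=> h1; rewrite lerBlDl; exact: h1.
Qed.

Lemma stirling_seq_le (R : realType) (k m : nat) : (0 < k)%N ->
  0 <= stirling_seq R k - stirling_seq R (k + m)
    <= (k%:R^-1 - (k + m)%:R^-1) / 4.
Proof.
move=> k_gt0; elim: m => [|m IH]; first by rewrite addn0 !subrr mul0r lexx.
have := @stirling_seq_step R (k + m); rewrite addn_gt0 k_gt0 => /(_ isT).
rewrite addnS; move: (k%:R^-1) ((k + m)%:R^-1) ((k + m).+1%:R^-1) IH => a b c.
by move=> /andP[h1 h2] /andP[h3 h4]; apply/andP; split; lra.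
Qed.

(** Take logarithms in [cbr_fact]: the terms linear in [k] and those in [k ln k] cancel. *)
Lemma ln_cbr (R : realType) (k : nat) : (0 < k)%N ->
  ln (cbr R k) = stirling_seq R k.*2 - 2 * stirling_seq R k
                 + (ln 2 - ln k%:R) / 2.
Proof.
move=> k_gt0; have k0 : 0 < k%:R :> R by rewrite ltr0n.
have f_gt0 := cbr_gt0 R k.
have fact_pos m : 0 < m`!%:R :> R by rewrite ltr0n fact_gt0.
have := congr1 (@ln R) (cbr_fact R k).
rewrite !lnM ?posrE ?mulr_gt0 ?exprn_gt0 // !lnXn //.
have -> : ln 4 = 2 * ln 2 :> R.
  have -> : 4 = 2 ^+ 2 :> R by ring.
  by rewrite lnXn // -[ln _ *+ 2]mulr_natl.
rewrite -[_ * _ *+ k]mulr_natl /stirling_seq => factE.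
by rewrite -factE -muln2 natrM lnM ?posrE //; field.
Qed.

(** No limit is taken: [wallis_ge] bounds [ln (cbr n)] below, and [ln_cbr] with
    [stirling_seq (2n) <= stirling_seq n] turns this into an upper bound on [stirling_seq n]. *)
Lemma ln_fact_le (R : realType) (n : nat) : (0 < n)%N ->
  ln n`!%:R <= (n%:R + 2^-1) * ln n%:R - n%:R + (ln 2 + ln pi) / 2
               + (4 * n%:R)^-1 :> R.
Proof.
move=> n_gt0; have n0 : 0 < n%:R :> R by rewrite ltr0n.
have f_gt0 := cbr_gt0 R n; have pi0 := pi_gt0 R.
have n21 : 0 < 2 * n%:R + 1 :> R by lra.
have : ln 2 <= ln (pi * ((2 * n%:R + 1) * cbr R n ^+ 2)).
  by rewrite ler_ln ?posrE ?mulr_gt0 ?exprn_gt0 ?wallis_ge.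
rewrite !lnM ?posrE ?mulr_gt0 ?exprn_gt0 //.
rewrite ln_cbr //.
have := stirling_seq_le R n n n_gt0; rewrite addnn => /andP[s2 _].
have : ln (2 * n%:R + 1) - ln 2 - ln n%:R <= (2 * n%:R)^-1 :> R.
  have -> : ln (2 * n%:R + 1) - ln 2 - ln n%:R = ln (1 + (2 * n%:R)^-1) :> R.
    rewrite -addrA -opprD -lnM ?posrE // -ln_div ?posrE ?mulr_gt0 //.
    by congr ln; field; lra.
  by apply: le_ln1Dx; apply: lt_trans (ltrN10 _) _; rewrite invr_gt0; lra.
have -> : (2 * n%:R)^-1 = 2 * (4 * n%:R)^-1 :> R by field; lra.
rewrite /stirling_seq in s2 *; lra.
Qed.

(* [ln k! + ln (cbr k)] is [stirling_seq 2k - stirling_seq k] plus explicit terms,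
   so the Stirling constant cancels. *)
Lemma ln_fact_cbr_ge (R : realType) (k : nat) :
  k%:R * ln k%:R - k%:R + ln 2 / 2 - (2 * k.+1%:R)^-1
  <= ln k`!%:R + ln (cbr R k) :> R.
Proof.
case: k => [|k].
  (* With [ln 0 = 0] the case [k = 0] reads [ln 2 / 2 - 1/2 <= 0]. *)
  rewrite fact0 /= ln1 mul0r mulr1.
  by have := @ln_le_subr1 R 2; lra.
have := stirling_seq_le R k.+1 k.+1 isT; rewrite addnn => /andP[_ s2].
rewrite ln_cbr //; set x : R := k.+1%:R in s2 *.
have x_ge1 : 1 <= x by rewrite /x ler1n.
have x2 : k.+1.*2%:R = 2 * x by rewrite -muln2 natrM mulrC.
(* The Stirling error [1/(8x)] is relaxed to the form whose binomial mean [binom_mean_invS_le]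
   bounds. *)
have : (x^-1 - (2 * x)^-1) / 4 <= (2 * (x + 1))^-1.
  have -> : (x^-1 - (2 * x)^-1) / 4 = (8 * x)^-1 by field; lra.
  by rewrite lef_pV2 ?posrE; lra.
rewrite x2 in s2; rewrite -[k.+2%:R]natr1 -/x.
have : stirling_seq R k.+1 = ln k.+1`!%:R - x * ln x - ln x / 2 + x.
  by rewrite /stirling_seq -/x; field.
move: (x^-1) ((2 * x)^-1) ((2 * (x + 1))^-1) s2 => a b c; lra.
Qed.

(** * Binomial moments *)

Definition binom_mean {R : realType} (n : nat) (x : R) (g : nat -> R) : R :=
  \sum_(k < n.+1) binom_W n k x * g k.

Lemma binom_W_ge0 (R : realType) (n k : nat) (x : R) :
  0 <= x <= 1 -> 0 <= binom_W n k x.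
Proof.
move=> /andP[x_ge0 x_le1].
by rewrite /binom_W !mulr_ge0 ?exprn_ge0 ?subr_ge0.
Qed.

Lemma binom_W_sym (R : realType) (n k : nat) (x : R) :
  (k <= n)%N -> binom_W n (n - k) (1 - x) = binom_W n k x.
Proof.
by move=> le_kn; rewrite /binom_W bin_sub // subKn // subKr mulrAC.
Qed.

Lemma binom_mean_sym (R : realType) (n : nat) (x : R) (g : nat -> R) :
  binom_mean n x (fun k => g (n - k)%N) = binom_mean n (1 - x) g.
Proof.
rewrite /binom_mean [RHS](reindex_inj rev_ord_inj) /=; apply: eq_bigr => k _.
by rewrite subSS binom_W_sym // -ltnS.
Qed.

Lemma eq_binom_mean (R : realType) (n : nat) (x : R) (g h : nat -> R) :
  (forall k, (k <= n)%N -> g k = h k) -> binom_mean n x g = binom_mean n x h.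
Proof. by move=> gh; apply: eq_bigr => k _; rewrite gh // -ltnS. Qed.

Lemma binom_meanD (R : realType) (n : nat) (x : R) (g h : nat -> R) :
  binom_mean n x (fun k => g k + h k) = binom_mean n x g + binom_mean n x h.
Proof.
by rewrite /binom_mean -big_split; apply: eq_bigr => k _; rewrite mulrDr.
Qed.

Lemma binom_meanZ (R : realType) (n : nat) (x a : R) (g : nat -> R) :
  binom_mean n x (fun k => a * g k) = a * binom_mean n x g.
Proof.
by rewrite /binom_mean mulr_sumr; apply: eq_bigr => k _; rewrite mulrCA.
Qed.

Lemma binom_mean1 (R : realType) (n : nat) (x : R) : binom_mean n x (fun=> 1) = 1.
Proof.
transitivity ((1 - x + x) ^+ n); last by rewrite subrK expr1n.
rewrite exprDn.
by apply: eq_bigr => k _; rewrite /binom_W; ring.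
Qed.

Lemma binom_mean_cst (R : realType) (n : nat) (x a : R) : binom_mean n x (fun=> a) = a.
Proof.
rewrite -[RHS]mulr1 -(binom_mean1 R n x) -binom_meanZ.
by apply: eq_bigr => k _; rewrite mulr1.
Qed.

Lemma le_binom_mean (R : realType) (n : nat) (x : R) (g h : nat -> R) :
  0 <= x <= 1 -> (forall k, (k <= n)%N -> g k <= h k) ->
  binom_mean n x g <= binom_mean n x h.
Proof.
move=> x01 gh; apply: ler_sum => k _.
by apply: ler_wpM2l; [exact: binom_W_ge0 | apply: gh; rewrite -ltnS].
Qed.

Lemma binom_W_le1 (R : realType) (n k : nat) (x : R) :
  (k <= n)%N -> 0 <= x <= 1 -> binom_W n k x <= 1.
Proof.
move=> le_kn x01; rewrite -(binom_mean1 R n x) /binom_mean.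
rewrite (bigD1 (Ordinal (le_kn : (k < n.+1)%N))) //= mulr1.
by rewrite lerDl sumr_ge0 // => i _; rewrite mulr1 binom_W_ge0.
Qed.

(** This is [k C(n+1,k) = (n+1) C(n,k-1)] under the sum; iterating it yields the factorial
    moments. *)
Lemma binom_mean_size_bias (R : realType) (n : nat) (x : R) (g : nat -> R) :
  binom_mean n.+1 x (fun k => k%:R * g k) = n.+1%:R * x * binom_mean n x (fun k => g k.+1).
Proof.
rewrite /binom_mean big_ord_recl mul0r mulr0 add0r mulr_sumr.
apply: eq_bigr => k _; rewrite lift0 /binom_W subSS exprS.
have : n.+1%:R * 'C(n, k)%:R = k.+1%:R * 'C(n.+1, k.+1)%:R :> R.
  by rewrite -!natrM mul_bin_diag.
move: ('C(n, k)%:R) ('C(n.+1, k.+1)%:R) => a b ab.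
transitivity (k.+1%:R * b * (x * x ^+ k * (1 - x) ^+ (n - k) * g k.+1)).
  by ring.
by rewrite -ab; ring.
Qed.

Lemma binom_mean_id (R : realType) (n : nat) (x : R) :
  binom_mean n x (fun k => k%:R) = n%:R * x.
Proof.
case: n => [|n].
  by rewrite /binom_mean big_ord1 mulr0 mul0r.
rewrite (eq_binom_mean _ _ _ _ (fun k => k%:R * 1)) => [|k _]; last by rewrite mulr1.
by rewrite (binom_mean_size_bias _ n x (fun=> 1)) binom_mean1 mulr1.
Qed.

Lemma binom_mean_ffact2 (R : realType) (n : nat) (x : R) :
  binom_mean n x (fun k => k%:R * (k%:R - 1)) = n%:R * (n%:R - 1) * x ^+ 2.
Proof.
case: n => [|n]; first by rewrite /binom_mean big_ord1 !mul0r mulr0.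
rewrite (binom_mean_size_bias _ n x (fun k => k%:R - 1)).
rewrite (eq_binom_mean _ _ _ _ (fun k => k%:R)) => [|k _]; last by rewrite -natr1 addrK.
by rewrite binom_mean_id -natr1; ring.
Qed.

Lemma binom_mean_ffact3 (R : realType) (n : nat) (x : R) :
  binom_mean n x (fun k => k%:R * ((k%:R - 1) * (k%:R - 2)))
  = n%:R * (n%:R - 1) * (n%:R - 2) * x ^+ 3.
Proof.
case: n => [|n]; first by rewrite /binom_mean big_ord1 !mul0r mulr0.
rewrite (binom_mean_size_bias _ n x (fun k => (k%:R - 1) * (k%:R - 2))).
rewrite (eq_binom_mean _ _ _ _ (fun k => k%:R * (k%:R - 1))) => [|k _].
  by rewrite binom_mean_ffact2 -[n.+1%:R]natr1; ring.
by rewrite -[k.+1%:R]natr1; ring.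
Qed.

Lemma binom_mean_variance (R : realType) (n : nat) (x : R) :
  binom_mean n x (fun k => (k%:R - n%:R * x) ^+ 2) = n%:R * x * (1 - x).
Proof.
set m := n%:R * x.
rewrite (eq_binom_mean _ _ _ _ (fun k => k%:R * (k%:R - 1)
  + ((1 - 2 * m) * k%:R + m ^+ 2))) => [|k _]; last by ring.
rewrite !binom_meanD binom_meanZ binom_mean_cst binom_mean_id.
by rewrite binom_mean_ffact2 /m; ring.
Qed.

Lemma binom_mean_third_central_moment (R : realType) (n : nat) (x : R) :
  binom_mean n x (fun k => (k%:R - n%:R * x) ^+ 3)
  = n%:R * x * (1 - x) * (1 - 2 * x).
Proof.
set m := n%:R * x.
(* The cube is expanded in falling factorials of [k], whose means are known. *)
rewrite (eq_binom_mean _ _ _ _ (fun k => k%:R * ((k%:R - 1) * (k%:R - 2))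
  + (3 * (1 - m) * (k%:R * (k%:R - 1))
  + ((1 - 3 * m + 3 * m ^+ 2) * k%:R + - m ^+ 3)))) => [|k _]; last by ring.
rewrite !binom_meanD !binom_meanZ binom_mean_cst binom_mean_id.
by rewrite binom_mean_ffact2 binom_mean_ffact3 /m; ring.
Qed.

(** Size biasing with [g k = 1/k] turns the mean, times [(n+1) x], into the mean of [k * (1/k)],
    which is [0] at [k = 0] and [1] elsewhere. *)
Lemma binom_mean_invS_le (R : realType) (n : nat) (x : R) : 0 < x <= 1 ->
  binom_mean n x (fun k => k.+1%:R^-1) <= (n.+1%:R * x)^-1.
Proof.
move=> /andP[x_gt0 x_le1]; have nx_gt0 : 0 < n.+1%:R * x by rewrite mulr_gt0.
rewrite -(ler_pM2l nx_gt0) divff ?gt_eqF //.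
rewrite -(binom_mean_size_bias _ n x (fun k => k%:R^-1)) -[leRHS](binom_mean1 R n.+1 x).
apply: le_binom_mean => [|k _]; first by rewrite ltW.
case: k => [|k]; first by rewrite mul0r.
by rewrite divff ?pnatr_eq0.
Qed.

Lemma binom_mean_xlnx_ge (R : realType) (n : nat) (x : R) : (0 < n)%N -> 0 < x <= 1 ->
  (1 - x) / 2 - (1 - x) * (1 - 2 * x) / (6 * (n%:R * x))
  <= binom_mean n x (fun k => k%:R * ln (k%:R / (n%:R * x))).
Proof.
move=> n_gt0 /andP[x_gt0 x_le1].
set m := n%:R * x.
have m_gt0 : 0 < m by rewrite mulr_gt0 // ltr0n.
(* [p k] is [m] times the cubic minorant of [u ln u] at [u = k / m]; its mean involves only the
   first three moments. *)
pose p (k : nat) : R := k%:R + - m + ((2 * m)^-1 * (k%:R - m) ^+ 2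
  + - (6 * m ^+ 2)^-1 * (k%:R - m) ^+ 3).
have <- : binom_mean n x p
    = (1 - x) / 2 - (1 - x) * (1 - 2 * x) / (6 * m).
  rewrite /p !binom_meanD !binom_meanZ binom_mean_cst binom_mean_id binom_mean_variance.
  by rewrite binom_mean_third_central_moment -/m; field; lra.
apply: le_binom_mean => [|k _]; first by rewrite ltW.
set u : R := k%:R / m.
have -> : k%:R = m * u :> R by rewrite /u mulrC divfK ?gt_eqF.
have u_ge0 : 0 <= u by rewrite divr_ge0 // ltW.
have := xlnx_ge_taylor3 R u u_ge0; rewrite -(ler_pM2l m_gt0) mulrA.
apply: le_trans; rewrite /p -/u.
have -> : k%:R = m * u :> R by rewrite /u mulrC divfK ?gt_eqF.
by rewrite le_eqVlt; apply/orP; left; apply/eqP; field; lra.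
Qed.

(** * Mutual information and divergence *)

Lemma integrable_sum_EFin d (T : measurableType d) (R : realType)
    (mu : {measure set T -> \bar R}) (D : set T) (m : nat)
    (f : nat -> T -> R) : measurable D ->
  (forall k, (k < m)%N -> mu.-integrable D (EFin \o f k)) ->
  mu.-integrable D (EFin \o (fun x => \sum_(k < m) f k x)).
Proof.
move=> mD f_int.
rewrite (_ : _ \o _ = (fun x => \sum_(k < m) (f k x)%:E)%E); last first.
  by apply/funext => x /=; rewrite sumEFin.
by apply: integrable_sum => // k _; exact: f_int.
Qed.

Lemma Rintegral_sum d (T : measurableType d) (R : realType)
    (mu : {measure set T -> \bar R}) (D : set T) (m : nat)
    (f : nat -> T -> R) : measurable D ->
  (forall k, (k < m)%N -> mu.-integrable D (EFin \o f k)) ->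
  Rintegral mu D (fun x => \sum_(k < m) f k x)
  = \sum_(k < m) Rintegral mu D (f k).
Proof.
move=> mD; elim: m => [_|m IH f_int].
  rewrite big_ord0 -[RHS](mul0r (fine (mu D))) -Rintegral_cst //.
  by apply: eq_Rintegral => x _; rewrite big_ord0.
transitivity (Rintegral mu D (fun x => (\sum_(k < m) f k x) + f m x)).
  by apply: eq_Rintegral => x _; rewrite big_ord_recr.
have f_int' k : (k < m)%N -> mu.-integrable D (EFin \o f k).
  by move=> lt_km; apply: f_int; exact: ltnW.
rewrite RintegralD //; first by rewrite big_ord_recr IH.
- exact: integrable_sum_EFin.
- exact: f_int.
Qed.

Lemma integrable_unit_itv (R : realType) (P : probability R R) (f : R -> R) (M : R) :
  measurable_fun setT f -> (forall x, 0 <= x <= 1 -> `|f x| <= M) ->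
  P.-integrable `[0, 1] (EFin \o f).
Proof.
move=> mf fM; apply: measurable_bounded_integrable => //.
- by rewrite (le_lt_trans (probability_le1 _ _)) // ltry.
- exact: measurable_funTS.
- exists M; split; first exact: num_real.
  move=> N lt_MN x /=; rewrite in_itv /= => /fM le_fM.
  exact: le_trans le_fM (ltW lt_MN).
Qed.

Lemma measurable_binom_W (R : realType) (n k : nat) :
  measurable_fun [set: R] (binom_W n k).
Proof.
apply: measurable_funM; first by apply: measurable_funM => //; apply: measurable_funX.
by apply: measurable_funX; apply: measurable_funB.
Qed.

Lemma mul_ln_div_ge (R : realType) (w q : R) :
  0 <= w -> 0 < q -> w - q <= w * ln (w / q).
Proof.
rewrite le0r => /orP[/eqP -> | w_gt0] q_gt0; first by rewrite mul0r; lra.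
have := ln_le_subr1 R (q / w) (divr_gt0 q_gt0 w_gt0) => h.
have : w * ln (q / w) <= w * (q / w - 1) by rewrite ler_pM2l.
rewrite mulrBr mulrCA divff ?gt_eqF // !ln_div ?posrE // !mulrBr; lra.
Qed.

Lemma mul_ln_bound (R : realType) (w c : R) : 0 <= w <= 1 -> 0 < c ->
  `|w * ln (w / c)| <= 1 + `|ln c|.
Proof.
move=> /andP[w_ge0 w_le1] c_gt0.
have := normr_ge0 (ln c) => c_abs.
move: w_ge0; rewrite le0r => /orP[/eqP -> | w_gt0].
  by rewrite mul0r normr0; lra.
rewrite ln_div ?posrE // mulrBr (le_trans (ler_normB _ _)) // lerD //.
  rewrite ler0_norm; last by rewrite mulr_ge0_le0 ?ln_le0 // ltW.
  by have := mul_ln_div_ge R w 1 (ltW w_gt0) ltr01; rewrite divr1; lra.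
by rewrite normrM gtr0_norm // ler_piMl.
Qed.

Lemma integrable_binom_W (R : realType) (P : probability R R) (n k : nat) :
  (k <= n)%N -> P.-integrable `[0, 1] (EFin \o binom_W n k).
Proof.
move=> le_kn; apply: (@integrable_unit_itv _ _ _ 1); first exact: measurable_binom_W.
by move=> x x01; rewrite ger0_norm ?binom_W_ge0 ?binom_W_le1.
Qed.

Lemma integrable_binom_W_ln (R : realType) (P : probability R R) (n k : nat)
    (c : R) : (k <= n)%N -> 0 < c ->
  P.-integrable `[0, 1] (EFin \o (fun x => binom_W n k x * ln (binom_W n k x / c))).
Proof.
move=> le_kn c_gt0; apply: (@integrable_unit_itv _ _ _ (1 + `|ln c|)).
  apply: measurable_funM; first exact: measurable_binom_W.
  apply: measurableT_comp; first exact: measurable_ln.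
  by apply: measurable_funM => //; exact: measurable_binom_W.
by move=> x x01; apply: mul_ln_bound => //; rewrite binom_W_ge0 ?binom_W_le1.
Qed.

Lemma Rintegral_unit_itv_cst (R : realType) (P : probability R R) (a : R) :
  P `[0, 1]%classic = 1%E -> Rintegral P `[0, 1] (fun=> a) = a.
Proof.
move=> P01; rewrite Rintegral_cst // -[RHS]mulr1; congr (_ * _).
by move: P01 => /(congr1 fine).
Qed.

(* Gibbs' inequality, term by term: the error [q - p] sums to something
   nonpositive. When [p = 0] the left-hand side is [0] by the junk values
   [w / 0 = 0] and [ln 0 = 0]. *)
Lemma Rintegral_binom_W_ln_le (R : realType) (P : probability R R) (n k : nat)
    (q : R) : P `[0, 1]%classic = 1%E -> (k <= n)%N -> 0 < q ->
  Rintegral P `[0, 1] (fun x => binom_W n k x * ln (binom_W n k x / binom_out P n k))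
  <= Rintegral P `[0, 1] (fun x => binom_W n k x * ln (binom_W n k x / q))
     + (q - binom_out P n k).
Proof.
move=> P01 le_kn q_gt0.
have W_int := integrable_binom_W R P n k le_kn.
have Wq_int := integrable_binom_W_ln R P n k q le_kn q_gt0.
have W01 x : `[0, 1]%classic x -> 0 <= binom_W n k x :> R.
  by rewrite /= in_itv /=; exact: binom_W_ge0.
have : 0 <= binom_out P n k by apply: Rintegral_ge0.
rewrite le0r => /orP[/eqP p_eq0 | p_gt0].
  rewrite (@eq_Rintegral _ _ _ _ _ (fun=> 0)) => [|x _]; last first.
    by rewrite p_eq0 invr0 mulr0 ln0 ?mulr0.
  (* The claim is now [p - q <= \int W ln (W/q)], which holds pointwise under the integral by
     [mul_ln_div_ge]. *)
  rewrite Rintegral_unit_itv_cst // -lerBlDr sub0r opprB.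
  have -> : binom_out P n k - q = Rintegral P `[0, 1] (fun x => binom_W n k x - q).
    rewrite RintegralB //; last exact: finite_measure_integrable_cst.
    by rewrite Rintegral_unit_itv_cst.
  apply: le_Rintegral => // [|x /W01].
    have q_int : P.-integrable `[0, 1] (EFin \o cst q).
      exact: finite_measure_integrable_cst.
    exact: (integrableB _ W_int q_int).
  by move=> w_ge0; exact: mul_ln_div_ge.
set p := binom_out P n k in p_gt0 *.
(* Writing the error as an integral against [W] reduces the claim to the pointwise inequality
   [ln (q/p) <= q/p - 1]. *)
have -> : q - p = Rintegral P `[0, 1] (fun x => (q / p - 1) * binom_W n k x).
  by rewrite RintegralZl // -/(binom_out P n k) -/p mulrBl divfK ?gt_eqF ?mul1r.
have cW_int : P.-integrable `[0, 1] (EFin \o (fun x => (q / p - 1) * binom_W n k x)).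
  exact: (integrableZl _ (q / p - 1) W_int).
rewrite -RintegralD //; apply: le_Rintegral => // [||x /W01].
- exact: integrable_binom_W_ln.
- exact: (integrableD _ Wq_int cW_int).
rewrite le0r => /orP[/eqP -> | w_gt0]; first by rewrite !mul0r mulr0 addr0.
rewrite [X in _ + X]mulrC -mulrDr ler_pM2l //.
have qp_gt0 : 0 < q / p by rewrite divr_gt0.
by have := ln_le_subr1 R _ qp_gt0; rewrite !ln_div ?posrE //; lra.
Qed.

(** Summing the termwise Gibbs bounds, the errors total [\sum q - 1 <= 0]; what remains is the
    [P]-average of the divergence at [x]. Allowing total mass below [1] accommodates truncated
    geometric laws. *)
Lemma binom_MI_le (R : realType) (P : probability R R) (n : nat) (q : nat -> R)
    (B : R) : P `[0, 1]%classic = 1%E ->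
  (forall k, (k <= n)%N -> 0 < q k) -> \sum_(k < n.+1) q k <= 1 ->
  (forall x : R, 0 <= x <= 1 ->
    binom_mean n x (fun k => ln (binom_W n k x / q k)) <= B) ->
  binom_MI P n <= B.
Proof.
move=> P01 q_gt0 q_sum divB.
have sum_p : \sum_(k < n.+1) binom_out P n k = 1.
  rewrite /binom_out -(@Rintegral_sum _ _ _ _ _ _ (fun k => binom_W n k)) //.
    rewrite (@eq_Rintegral _ _ _ _ _ (fun=> 1)) => [|x _].
      by rewrite Rintegral_unit_itv_cst.
    by rewrite -(binom_mean1 R n x); apply: eq_bigr => k _; rewrite mulr1.
  by move=> k le_kn; exact: (integrable_binom_W R P n k le_kn).
apply: (@le_trans _ _ (\sum_(k < n.+1) (Rintegral P `[0, 1]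
    (fun x => binom_W n k x * ln (binom_W n k x / q k)) + (q k - binom_out P n k)))).
  apply: ler_sum => k _; apply: Rintegral_binom_W_ln_le => //.
    by rewrite -ltnS.
  by apply: q_gt0; rewrite -ltnS.
rewrite big_split /= sumrB sum_p.
rewrite -(@Rintegral_sum _ _ _ _ _ _
  (fun k x => binom_W n k x * ln (binom_W n k x / q k))) //; last first.
  by move=> k le_kn; apply: integrable_binom_W_ln => //; exact: q_gt0.
suff : Rintegral P `[0, 1] (fun x =>
  \sum_(k < n.+1) binom_W n k x * ln (binom_W n k x / q k)) <= B by lra.
have <- : Rintegral P `[0, 1] (fun=> B) = B.
  by rewrite Rintegral_unit_itv_cst.
apply: le_Rintegral => //.
- apply: (@integrable_sum_EFin _ _ _ _ _ _
    (fun k x => binom_W n k x * ln (binom_W n k x / q k))) => // k le_kn.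
  by apply: integrable_binom_W_ln => //; exact: q_gt0.
- exact: finite_measure_integrable_cst.
Qed.

(** * Divergence from the Jeffreys law *)

(** Lets a single component of a mixture stand in for the whole mixture. *)
Lemma binom_mean_ln_homo (R : realType) (n : nat) (x : R) (q r : nat -> R) :
  0 <= x <= 1 -> (forall k, (k <= n)%N -> 0 < r k <= q k) ->
  binom_mean n x (fun k => ln (binom_W n k x / q k))
  <= binom_mean n x (fun k => ln (binom_W n k x / r k)).
Proof.
move=> x01 rq; apply: ler_sum => k _.
have /rq /andP[r_gt0 le_rq] : (k <= n)%N by rewrite -ltnS.
have := binom_W_ge0 R n k x x01.
rewrite le0r => /orP[/eqP -> | w_gt0]; first by rewrite !mul0r.
rewrite ler_pM2l // ler_ln ?posrE ?divr_gt0 //; last exact: lt_le_trans le_rq.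
by rewrite ler_pM2l // lef_pV2 ?posrE //; exact: lt_le_trans le_rq.
Qed.

Lemma binom_mean_ln_le (R : realType) (n : nat) (x : R) (r : nat -> R) :
  0 <= x <= 1 -> (forall k, (k <= n)%N -> 0 < r k) ->
  binom_mean n x (fun k => ln (binom_W n k x / r k))
  <= binom_mean n x (fun k => - ln (r k)).
Proof.
move=> x01 r_gt0; apply: ler_sum => k _.
have le_kn : (k <= n)%N by rewrite -ltnS.
have := binom_W_ge0 R n k x x01.
rewrite le0r => /orP[/eqP -> | w_gt0]; first by rewrite !mul0r.
rewrite ler_pM2l // ln_div ?posrE ?r_gt0 // gerDr ln_le0 //.
exact: binom_W_le1.
Qed.

Lemma binom_mean_ln_scale (R : realType) (n : nat) (x c : R) (r : nat -> R) :
  0 <= x <= 1 -> 0 < c -> (forall k, (k <= n)%N -> 0 < r k) ->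
  binom_mean n x (fun k => ln (binom_W n k x / (c * r k)))
  = binom_mean n x (fun k => ln (binom_W n k x / r k)) - ln c.
Proof.
move=> x01 c_gt0 r_gt0.
rewrite -[X in _ - X](binom_mean_cst R n x) -mulN1r -binom_meanZ -binom_meanD.
apply: eq_bigr => k _.
have rk_gt0 : 0 < r k by apply: r_gt0; rewrite -ltnS.
have := binom_W_ge0 R n k x x01.
rewrite le0r => /orP[/eqP -> | w_gt0]; first by rewrite !mul0r.
have crk_gt0 : 0 < c * r k by rewrite mulr_gt0.
by rewrite !ln_div ?posrE // lnM ?posrE //; ring.
Qed.

(** The quotient pairs [k!] with [cbr k] and [(n-k)!] with [cbr (n-k)], so [ln_fact_cbr_ge] applies
    twice and [ln_fact_le] once. *)
Lemma ln_binom_W_div_jeffreys_le (R : realType) (n k : nat) (x : R) :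
  (0 < n)%N -> (k <= n)%N -> 0 < x < 1 ->
  ln (binom_W n k x / (cbr R k * cbr R (n - k)))
  <= (ln n%:R + ln pi - ln 2) / 2 + (4 * n%:R)^-1
     + 2^-1 * k.+1%:R^-1 + 2^-1 * (n - k).+1%:R^-1
     - k%:R * ln (k%:R / (n%:R * x))
     - (n - k)%:R * ln ((n - k)%:R / (n%:R * (1 - x))).
Proof.
move=> n_gt0 le_kn /andP[x_gt0 x_lt1].
have y_gt0 : 0 < 1 - x by rewrite subr_gt0.
have n0 : 0 < n%:R :> R by rewrite ltr0n.
have fact_pos m : 0 < m`!%:R :> R by rewrite ltr0n fact_gt0.
have C_gt0 : 0 < 'C(n, k)%:R :> R by rewrite ltr0n bin_gt0.
(* At [m = 0] the factor [m] annihilates the default value of [ln 0]. *)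
have xlnE m (y : R) : 0 < y ->
    m%:R * ln (m%:R / (n%:R * y)) = m%:R * (ln m%:R - ln n%:R - ln y).
  case: m => [|m] y0; first by rewrite !mul0r.
  by rewrite ln_div ?posrE ?mulr_gt0 // lnM ?posrE // opprD addrA.
have lnC : ln 'C(n, k)%:R = ln n`!%:R - ln k`!%:R - ln (n - k)`!%:R :> R.
  by rewrite -(bin_fact le_kn) !natrM !lnM ?posrE ?mulr_gt0 //; ring.
rewrite /binom_W ln_div ?posrE ?mulr_gt0 ?exprn_gt0 ?cbr_gt0 //.
rewrite lnM ?posrE ?mulr_gt0 ?exprn_gt0 // lnM ?posrE ?mulr_gt0 ?exprn_gt0 //.
rewrite lnM ?posrE ?cbr_gt0 // !lnXn // !xlnE // lnC.
rewrite -[ln x *+ k]mulr_natl -[ln (1 - x) *+ _]mulr_natl.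
have := ln_fact_le R n n_gt0.
have := ln_fact_cbr_ge R k; have := ln_fact_cbr_ge R (n - k).
rewrite !invfM; move: (ln n%:R) (n%:R^-1) (k.+1%:R^-1) ((n - k).+1%:R^-1).
have -> : n%:R = k%:R + (n - k)%:R :> R by rewrite -natrD subnKC.
move: (ln n`!%:R) (ln k`!%:R) (ln (n - k)`!%:R) (ln (cbr R k)).
move: (ln (cbr R (n - k))) (ln k%:R) (ln (n - k)%:R).
move: k%:R (n - k)%:R.
move: (ln x) (ln (1 - x)) (ln 2) (ln pi).
by move=> *; lra.
Qed.

Lemma jeffreys_divergence_le (R : realType) (n : nat) (x : R) :
  (0 < n)%N -> 0 < x < 1 ->
  binom_mean n x (fun k => ln (binom_W n k x / (cbr R k * cbr R (n - k))))
  <= (ln n%:R + ln pi - ln 2 - 1) / 2 + (n%:R * x * (1 - x))^-1.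
Proof.
move=> n_gt0 x01; have [x_gt0 x_lt1] := andP x01.
have x_lt1' : 0 < x <= 1 by rewrite x_gt0 ltW.
have y_gt0 : 0 < 1 - x <= 1 by apply/andP; split; lra.
have n0 : 0 < n%:R :> R by rewrite ltr0n.
pose c : R := (ln n%:R + ln pi - ln 2) / 2 + (4 * n%:R)^-1.
pose inv1 (k : nat) : R := k.+1%:R^-1.
pose xlog (y : R) (k : nat) : R := k%:R * ln (k%:R / (n%:R * y)).
apply: (@le_trans _ _ (binom_mean n x (fun k => c + (2^-1 * inv1 k
   + (2^-1 * inv1 (n - k)%N + (-1 * xlog x k + -1 * xlog (1 - x) (n - k)%N)))))).
  apply: le_binom_mean => [|k le_kn]; first by rewrite !ltW.
  apply: le_trans (ln_binom_W_div_jeffreys_le R n k x n_gt0 le_kn x01) _.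
  by rewrite le_eqVlt; apply/orP; left; apply/eqP; rewrite /c /inv1 /xlog; ring.
rewrite !binom_meanD !binom_meanZ !binom_mean_cst !binom_mean_sym.
have := binom_mean_invS_le R n x x_lt1'.
have := binom_mean_invS_le R n (1 - x) y_gt0.
have := binom_mean_xlnx_ge R n x n_gt0 x_lt1'.
have := binom_mean_xlnx_ge R n (1 - x) n_gt0 y_gt0.
rewrite -/inv1 -/(xlog x) -/(xlog (1 - x)) /c.
move: (binom_mean n x inv1) (binom_mean n (1 - x) inv1).
move: (binom_mean n x (xlog x)) (binom_mean n (1 - x) (xlog (1 - x))).
move=> e1 e2 e3 e4 h1 h2 h3 h4.
set V := (n%:R * x * (1 - x))^-1.
have V_gt0 : 0 < V by rewrite invr_gt0 !mulr_gt0 //; lra.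
have inv4 : (4 * n%:R)^-1 = x * (1 - x) / 4 * V by rewrite /V; field; lra.
have le_inv : (n.+1%:R * x)^-1 + (n.+1%:R * (1 - x))^-1 <= V.
  have -> : (n.+1%:R * x)^-1 + (n.+1%:R * (1 - x))^-1 = (n.+1%:R * x * (1 - x))^-1.
    by have := ltr0Sn R n => n1; field; lra.
  rewrite lef_pV2 ?posrE ?mulr_gt0 ?ltr0Sn //; try lra.
  by rewrite !ler_pM2r ?ler_nat //; lra.
have third : (1 - x) * (1 - 2 * x) / (6 * (n%:R * x))
    + (1 - (1 - x)) * (1 - 2 * (1 - x)) / (6 * (n%:R * (1 - x)))
    = (1 - 2 * x) ^+ 2 / 6 * V by rewrite /V; field; lra.
(* Every error term is now a multiple of [V]. With [s = x (1 - x)] the coefficients add up to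
   [2/3 - 5s/12]. *)
have coef : x * (1 - x) / 4 * V + 2^-1 * V + (1 - 2 * x) ^+ 2 / 6 * V <= V.
  rewrite -!mulrDl ger_pMl //.
  have -> : (1 - 2 * x) ^+ 2 = 1 - 4 * (x * (1 - x)) by ring.
  have : 0 < x * (1 - x) by apply: mulr_gt0 => //; lra.
  lra.
move: third le_inv h1 h2 h3 h4.
move: ((1 - x) * (1 - 2 * x) / (6 * (n%:R * x))).
move: ((1 - (1 - x)) * (1 - 2 * (1 - x)) / (6 * (n%:R * (1 - x)))).
rewrite inv4; move: coef; move: (x * (1 - x) / 4 * V) ((1 - 2 * x) ^+ 2 / 6 * V).
move: ((n.+1%:R * x)^-1) ((n.+1%:R * (1 - x))^-1) (ln n%:R + ln pi - ln 2).
by move=> *; lra.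
Qed.

(** * The mixed output law *)

Lemma sum_geometric_half_le1 (R : realType) (n : nat) :
  \sum_(k < n.+1) (2^-1 : R) ^+ k.+1 <= 1.
Proof.
suff -> : \sum_(k < n.+1) (2^-1 : R) ^+ k.+1 = 1 - 2^-1 ^+ n.+1.
  by rewrite gerBl exprn_ge0 // invr_ge0.
elim: n => [|n IH]; first by rewrite big_ord1 expr1; field.
by rewrite big_ord_recr /= IH (exprS _ n.+1); field.
Qed.

Lemma half_le_ln2 (R : realType) : 2^-1 <= ln 2 :> R.
Proof.
have := ln_ge_pade R 2; rewrite ler1n => /(_ isT); lra.
Qed.

Lemma ln2_le (R : realType) : ln 2 <= 3 / 4 :> R.
Proof.
have := ln_le_sqr R 2; rewrite ler1n => /(_ isT); rewrite expr2; lra.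
Qed.

(** Minus the logarithm of a geometric weight is affine in [k], so only the mean [n x] enters;
    [ln W <= 0] is discarded. *)
Lemma binom_mean_ln_geometric_le (R : realType) (n : nat) (x c : R)
    (q : nat -> R) : 0 <= x <= 1 -> 0 < c ->
  (forall k, (k <= n)%N -> c * 2^-1 ^+ k.+1 <= q k) ->
  binom_mean n x (fun k => ln (binom_W n k x / q k))
  <= (n%:R * x + 1) * ln 2 - ln c.
Proof.
move=> x01 c_gt0 q_ge.
have h_gt0 k : 0 < (2^-1 : R) ^+ k by rewrite exprn_gt0.
have r_gt0 k : 0 < c * 2^-1 ^+ k.+1 by rewrite mulr_gt0.
apply: (@le_trans _ _ (binom_mean n x
    (fun k => ln (binom_W n k x / (c * 2^-1 ^+ k.+1))))).
  by apply: binom_mean_ln_homo => // k le_kn; rewrite r_gt0 q_ge.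
apply: le_trans (binom_mean_ln_le _ _ _ _ x01 (fun k _ => r_gt0 k)) _.
rewrite (eq_binom_mean _ _ _ _ (fun k => ln 2 * k%:R + (ln 2 - ln c))) => [|k _].
  by rewrite binom_meanD binom_meanZ binom_mean_cst binom_mean_id; lra.
rewrite lnM ?posrE // lnXn // lnV ?posrE // -[_ *+ _]mulr_natl -[k.+1%:R]natr1.
ring.
Qed.

(** For [x <= 1/2] one has [n x <= 2 n x (1 - x)], so the left law suffices; reflecting [k] to
    [n - k] handles the other half. *)
Lemma binom_mean_ln_two_sided_geometric_le (R : realType) (n : nat) (x c : R)
    (q : nat -> R) : 0 <= x <= 1 -> 0 < c ->
  (forall k, (k <= n)%N -> c * 2^-1 ^+ k.+1 <= q k) ->
  (forall k, (k <= n)%N -> c * 2^-1 ^+ (n - k).+1 <= q k) ->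
  binom_mean n x (fun k => ln (binom_W n k x / q k))
  <= (2 * (n%:R * x * (1 - x)) + 1) * ln 2 - ln c.
Proof.
move=> x01 c_gt0 q_l q_r.
have l2 := half_le_ln2 R; have n_ge0 := ler0n R n.
have [x_le | x_ge] := leP x 2^-1.
  apply: le_trans (binom_mean_ln_geometric_le _ _ _ _ _ x01 c_gt0 q_l) _.
  rewrite lerD2r ler_wpM2r //; first by lra.
  have : 0 <= n%:R * x * (1 - 2 * x) by apply: mulr_ge0; [apply: mulr_ge0|]; lra.
  have -> : n%:R * x * (1 - 2 * x) = 2 * (n%:R * x * (1 - x)) - n%:R * x by ring.
  lra.
have y01 : 0 <= 1 - x <= 1 by apply/andP; split; lra.
have -> : binom_mean n x (fun k => ln (binom_W n k x / q k))
    = binom_mean n (1 - x) (fun k => ln (binom_W n k (1 - x) / q (n - k)%N)).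
  rewrite -binom_mean_sym; apply: eq_binom_mean => k le_kn.
  by rewrite binom_W_sym // subKn.
apply: le_trans (binom_mean_ln_geometric_le _ _ _ _ _ y01 c_gt0 _) _.
  by move=> k le_kn; rewrite -{1}(subKn le_kn) q_r // leq_subr.
rewrite lerD2r ler_wpM2r //; first by lra.
have : 0 <= n%:R * (1 - x) * (2 * x - 1) by apply: mulr_ge0; [apply: mulr_ge0|]; lra.
have -> : n%:R * (1 - x) * (2 * x - 1)
  = 2 * (n%:R * x * (1 - x)) - n%:R * (1 - x) by ring.
lra.
Qed.

(** The uniform output law, used for the small [n] where the mixture weight [1 - 2e] is not
    positive. *)
Lemma binom_MI_le_ln (R : realType) (n : nat) (P : probability R R) :
  P `[0, 1]%classic = 1%E -> binom_MI P n <= ln n.+1%:R.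
Proof.
move=> P01; have n1 : 0 < n.+1%:R^-1 :> R by rewrite invr_gt0.
apply: (@binom_MI_le _ _ _ (fun=> n.+1%:R^-1)) => // [|x x01].
  by rewrite sumr_const card_ord -[_ *+ _]mulr_natl divff // pnatr_eq0.
apply: le_trans (binom_mean_ln_le _ _ _ _ x01 (fun _ _ => n1)) _.
by rewrite binom_mean_cst lnV ?opprK ?posrE.
Qed.

Definition mixed_law (R : realType) (n : nat) (e : R) (k : nat) : R :=
  (1 - 2 * e) * (cbr R k * cbr R (n - k))
  + e * 2^-1 ^+ k.+1 + e * 2^-1 ^+ (n - k).+1.

(** The Jeffreys part has mass exactly [1 - 2e] by [sum_cbr_cbr]; each truncated geometric part has
    mass at most [e]. *)
Lemma sum_mixed_law_le1 (R : realType) (n : nat) (e : R) : 0 < e ->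
  \sum_(k < n.+1) mixed_law R n e k <= 1.
Proof.
move=> e_gt0; rewrite /mixed_law !big_split /= -!mulr_sumr sum_cbr_cbr.
rewrite [X in _ + e * X](reindex_inj rev_ord_inj) /=.
have -> : \sum_(k < n.+1) (2^-1 : R) ^+ (n - (n.+1 - k.+1)).+1
    = \sum_(k < n.+1) (2^-1 : R) ^+ k.+1.
  by apply: eq_bigr => k _; rewrite subSS subKn // -ltnS.
have := sum_geometric_half_le1 R n; set s := \sum_(k < n.+1) _ => s_le1.
have : e * s <= e * 1 by rewrite ler_pM2l.
by move: (e * s) => t; lra.
Qed.

Lemma mixed_law_divergence_le (R : realType) (n : nat) (e l x : R) :
  (0 < n)%N -> 0 <= x <= 1 -> 0 < l -> 0 < e -> 0 < 1 - 2 * e ->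
  l = ln n%:R + ln pi - ln 2 - 1 -> ln e = - l / 4 ->
  binom_mean n x (fun k => ln (binom_W n k x / mixed_law R n e k))
  <= l / 2 - ln (1 - 2 * e) + 10 / l.
Proof.
move=> n_gt0 x01 l_gt0 e_gt0 e2_gt0 lE ln_e.
have n0 : 0 < n%:R :> R by rewrite ltr0n.
have f_gt0 k : 0 < cbr R k * cbr R (n - k) by rewrite mulr_gt0 ?cbr_gt0.
have h_gt0 k : 0 < (2^-1 : R) ^+ k by rewrite exprn_gt0.
have eh_gt0 k : 0 < e * 2^-1 ^+ k by rewrite mulr_gt0.
have [v_ge | v_lt] := leP (l / 10) (n%:R * x * (1 - x)).
  (* Here [1/v <= 10/l], and [v > 0] excludes the endpoints [x = 0] and [x = 1]. *)
  have v_gt0 : 0 < n%:R * x * (1 - x) by lra.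
  have x01' : 0 < x < 1.
    have [/eqP x0 | x_neq0] := boolP (x == 0); first by move: v_gt0; rewrite x0; lra.
    have [/eqP x1 | x_neq1] := boolP (x == 1); first by move: v_gt0; rewrite x1; lra.
    by move: x01; rewrite !le_eqVlt eq_sym (negbTE x_neq0) (negbTE x_neq1).
  apply: (@le_trans _ _ (binom_mean n x (fun k =>
      ln (binom_W n k x / ((1 - 2 * e) * (cbr R k * cbr R (n - k))))))).
    apply: binom_mean_ln_homo => // k _; rewrite mulr_gt0 //= /mixed_law -addrA.
    by rewrite lerDl addr_ge0 // ltW // mulr_gt0.
  rewrite (@binom_mean_ln_scale _ _ _ _ (fun k => cbr R k * cbr R (n - k))) //.
  have := jeffreys_divergence_le R n x n_gt0 x01'; rewrite -lE.
  have : (n%:R * x * (1 - x))^-1 <= (l / 10)^-1.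
    by rewrite lef_pV2 ?posrE // divr_gt0.
  by rewrite invf_div; lra.
have q_l k : e * 2^-1 ^+ k.+1 <= mixed_law R n e k.
  by rewrite /mixed_law addrAC lerDr addr_ge0 // ltW // mulr_gt0.
have q_r k : e * 2^-1 ^+ (n - k).+1 <= mixed_law R n e k.
  by rewrite /mixed_law lerDr addr_ge0 // ltW // mulr_gt0.
apply: le_trans (binom_mean_ln_two_sided_geometric_le _ _ _ _ _ x01 e_gt0
  (fun k _ => q_l k) (fun k _ => q_r k)) _.
have l1 := half_le_ln2 R; have l2 := ln2_le R.
have l3 : ln (1 - 2 * e) <= 0 by rewrite ln_le0; lra.
have : (2 * (n%:R * x * (1 - x)) + 1) * ln 2 <= (l / 5 + 1) * (3 / 4).
  apply: ler_pM => //; try lra.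
  have : 0 <= n%:R * x * (1 - x) by rewrite !mulr_ge0 //; lra.
  lra.
(* With [- ln e = l/4], the goal follows from [3l/20 + 3/4 + l/4 <= l/2 + 10/l], which is this
   inequality; its right-hand side is at least [2] by AM-GM. *)
have : 3 / 4 <= l / 10 + 10 / l.
  have -> : l / 10 + 10 / l = 2 + (l - 10) ^+ 2 / (10 * l) by field; lra.
  have : 0 <= (l - 10) ^+ 2 / (10 * l) by rewrite divr_ge0 ?sqr_ge0 //; lra.
  lra.
by rewrite ln_e; move: (10 / l) => *; lra.
Qed.

(* C(n) = sup over input laws P_X on [0,1] of I(X;Y); "C(n) <= B" is stated as
   "I(X;Y) <= B for every probability measure P_X concentrated on [0,1]". *)
Theorem theorem2 (R : realType) (n : nat) (P : probability R R) :
  (28 <= n)%N -> P `[0, 1]%classic = 1%E ->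
  binom_MI P n <= 2^-1 * ln ((n%:R * pi) / (2 * expR 1)) + r_UB n.
Proof.
move=> n28 P01.
have n_gt0 : (0 < n)%N by apply: leq_trans n28.
have n_ge28 : 28 <= n%:R :> R by rewrite ler_nat.
have n0 : 0 < n%:R :> R by lra.
have pi_pos := pi_gt0 R; have e_pos := expR_gt0 (1 : R).
set t : R := n%:R * pi / (2 * expR 1).
have t_gt0 : 0 < t by rewrite divr_gt0 ?mulr_gt0.
set l := ln t; have lE : l = ln n%:R + ln pi - ln 2 - 1.
  rewrite /l ln_div ?posrE ?mulr_gt0 // !lnM ?posrE // expRK; ring.
have l2_lo := half_le_ln2 R; have l2_hi := ln2_le R.
have ln_pi : ln 2 <= ln pi :> R by rewrite ler_ln ?posrE ?pi_ge2.
(* From [n >= 2^4] and [pi >= 2], [l >= 4 ln 2 - 1 >= 1]. *)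
have l_ge1 : 1 <= l.
  have : ln (2 ^+ 4) <= ln n%:R :> R.
    by rewrite ler_ln ?posrE ?exprn_gt0 // -natrX ler_nat (leq_trans _ n28).
  rewrite lnXn // -[_ *+ 4]mulr_natl; lra.
rewrite /r_UB -/t -/l -[2 * expR 1 / _]invf_div -/t.
set e := powR t^-1 4^-1.
have e_gt0 : 0 < e by rewrite powR_gt0 ?invr_gt0.
have ln_e : ln e = - l / 4 by rewrite ln_powR lnV ?posrE // -/l; field.
have [e2_gt0 | e2_le0] := ltP 0 (1 - 2 * e).
  apply: (@binom_MI_le _ _ _ (mixed_law R n e)) => // [k _||x x01].
  - rewrite /mixed_law addr_gt0 ?addr_gt0 ?mulr_gt0 ?cbr_gt0 ?exprn_gt0 //.
  - exact: sum_mixed_law_le1.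
  - by rewrite addrA mulrC; apply: mixed_law_divergence_le => //; lra.
(* Here [ln (1 - 2 * e)] is the junk value [0], and [n] is bounded. *)
apply: le_trans (binom_MI_le_ln _ _ _ P01) _.
have -> : ln (1 - 2 * e) = 0 by rewrite ln0.
(* Now [e >= 1/2], so [l = - 4 ln e <= 4 ln 2 <= 3]. *)
have l_le3 : l <= 3.
  have : ln 2^-1 <= ln e by rewrite ler_ln ?posrE //; lra.
  by rewrite lnV ?posrE // ln_e; lra.
have : ln n.+1%:R - ln n%:R <= 28^-1 :> R.
  rewrite -ln_div ?posrE //.
  have -> : n.+1%:R / n%:R = 1 + n%:R^-1 :> R.
    by rewrite -natr1 mulrDl divff ?gt_eqF // mul1r.
  apply: (@le_trans _ _ (n%:R^-1 : R)); last by rewrite lef_pV2 ?posrE.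
  by apply: le_ln1Dx; apply: lt_trans (ltrN10 _) _; rewrite invr_gt0.
(* Since [ln n <= l + 1], it remains that [l/2 + 1 + 1/28 <= 10/3], true for [l <= 3]. *)
have : 10 / 3 <= 10 / l by rewrite ler_pM2l // lef_pV2 ?posrE //; lra.
by move: (10 / l) => *; lra.
Qed.
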